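(* Let $G$ be a permutation group of degree $n\ne 3$. If $\alpha_{2,1}(G)=\lfloor n/2\rfloor$, then $e(G)\le\lfloor n/2\rfloor+\nu$, where $\nu=\sum_{j\ge0}\bigl(1-\prod_{l\ge1}(1-2^{-(j+l)})\bigr)\approx 1.606695$.
   Context: $\alpha_{2,1}(G)$ is the number of complemented chief factors of order $2$ in a chief series of $G$. $e(G)$ is the expected number of uniformly random elements of $G$, drawn independently with replacement, needed until they generate $G$; equivalently $e(G)=\sum_{n\ge0}(1-P_G(n))$ with $P_G(n)$ the probability that $n$ random elements generate $G$. *)

(* Defs.v *)
From Stdlib Require Import Reals.
From mathcomp Require Import all_boot all_fingroup all_solvable.

Set Implicit Arguments.
Unset Strict Implicit.
Unset Printing Implicit Defensive.

Local Open Scope group_scope.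

Definition complemented_factor (gT : finGroupType) (G V U : {group gT}) : bool :=
  [exists L : {group gT}, [&& L \subset G, L :&: U == V & L * U == G]].

Definition chief_series (gT : finGroupType) (G : {group gT}) (s : seq {group gT}) : Prop :=
  path.path (fun V U : {group gT} => chief_factor G V U) 1%G s /\ last 1%G s = G.

Definition alpha21_of (gT : finGroupType) (G : {group gT}) (s : seq {group gT}) : nat :=
  count (fun p : {group gT} * {group gT} =>
           (#|p.2 : p.1| == 2)%N && complemented_factor G p.1 p.2)
        (zip (1%G :: s) s).

Definition gen_count (gT : finGroupType) (G : {group gT}) (k : nat) : nat :=
  #|[set t : {ffun 'I_k -> gT} |
      [forall i, t i \in G] && (<<[set t i | i : 'I_k]>> == G)]|.

Definition probgen (gT : finGroupType) (G : {group gT}) (k : nat) : R :=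
  Rdiv (INR (gen_count G k)) (INR (expn #|G| k)).

Fixpoint nu_partial_prod (j m : nat) : R :=
  match m with
  | O => Rdefinitions.R1
  | S m' => Rmult (nu_partial_prod j m') (Rminus Rdefinitions.R1 (Rinv (pow (INR 2) (j + m)%N)))
  end.

(* Main.v *)
Require Import Defs.
From Stdlib Require Import Reals Lra.
From mathcomp Require Import all_boot all_fingroup all_solvable zify.

(* The number of complemented chief factors of order 2 is the rank d of the largest
   elementary abelian 2-quotient of G, so a Sylow 2-subgroup P needs at least d generators;
   as a 2-group of degree n needs at most n./2 generators, d = n./2 forces P to be extremal
   and its Frattini subgroup to be the trace on P of the kernel K of that quotient. Tate's
   theorem then yields a normal complement N of P, of odd order. Extremality of P leaves only
   N = 1 or #|N| = 3, with n odd in the second case. Hence the probability that k elements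
   generate G is prod_(i < d) (1 - 2^(i - k)), or at least this product times 1 - 3^(1 - k),
   and both are compared termwise with the infinite products defining nu; only for n = 5
   do the first terms have to be added up. *)

Set Implicit Arguments.
Unset Strict Implicit.
Unset Printing Implicit Defensive.

Local Open Scope group_scope.

(** * Generators of 2-groups of permutations *)

(** Extremality is exploited through one principle: [P] cannot act faithfully on an invariant set
    that is too small, since its rank would drop below [n./2]. To cover unfaithful actions and the
    kernels that arise, the generator bound is stated for the index of ['Phi(P) <*> 'C_P(S | to)],
    which is multiplicative along a chain of kernels ([index_joing_mul]). The degree 3 has to be
    excluded: the symmetric group of degree 3 has rank d = 1, but its e = 29/10 exceeds 1 + nu. *)

Lemma index_joing_mul (gT : finGroupType) (P F K C : {group gT}) :
    F <| P -> K \subset P -> C \subset K ->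
  #|P : F <*> C| = (#|P : F <*> K| * #|K : F <*> C|)%N.
Proof.
case/andP=> sFP nFP sKP sCK.
have nFK := subset_trans sKP nFP; have nFC := subset_trans sCK nFK.
rewrite -(@Lagrange_index _ P (F <*> K) (F <*> C)) ?join_subG ?sFP ?joing_subl //=; last first.
  by rewrite (subset_trans sCK) ?joing_subr.
congr (_ * _)%N.
have -> : F <*> K = (F <*> C)%G * K.
  by rewrite /= (norm_joinEr nFK) (norm_joinEr nFC) -mulgA (mulSGid sCK).
exact: indexMg.
Qed.

(** Cutting [W] with the members of [s] one at a time at most doubles the index at each step. The
    index hypothesis ranges over all [X \subset W] so that it passes to [W :&: A]. *)
Lemma index_bigcap_leq (gT : finGroupType) (s : seq {group gT}) (W D : {group gT}) :
    (forall A X : {group gT}, A \in s -> X \subset W -> #|X : A| <= 2) ->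
    (forall w, w \in W -> {in s, forall A : {group gT}, w \in A} -> w \in D) ->
  #|W : D| <= 2 ^ size s.
Proof.
elim: s W => [|A s IHs] W leW capW.
  by rewrite leq_eqVlt indexg_eq1; apply/orP; left; apply/subsetP=> w Ww; exact: capW.
have leWD : #|W :&: A : D| <= 2 ^ size s.
  apply: IHs => [B X sB sX | w /setIP[Ww Aw] sw].
    by apply: leW; rewrite ?inE ?sB ?orbT ?(subset_trans sX) ?subsetIl.
  by apply: capW => // B; rewrite inE => /predU1P[-> | /sw].
have leWA : #|W : W :&: A| <= 2 by rewrite indexgI leW ?mem_head.
apply: leq_trans (_ : #|W : W :&: A :&: D| <= _).
  by rewrite dvdn_leq ?indexg_gt0 // indexgS ?subsetIr.
rewrite -(@Lagrange_index _ W (W :&: A) (W :&: A :&: D)) ?subsetIl //= expnS.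
by rewrite leq_mul //= indexgI.
Qed.

Lemma subgroup_index2_step (gT : finGroupType) (P H : {group gT}) :
    2.-group P -> H \proper P ->
  exists J : {group gT}, [/\ H <| J, #|J : H| = 2 & J \subset P].
Proof.
move=> pP ltHP.
have [|J /mingroupP[/andP[ltHJ sJP] minJ]] :=
    @ex_mingroup _ (fun J : {group gT} => (H \proper J) && (J \subset P)).
  by exists P; rewrite ltHP subxx.
have maxH : maximal H J.
  apply/maxgroupP; split=> // L ltLJ sHL; apply/eqP; rewrite eqEsubset sHL andbT.
  apply: contraLR (ltLJ) => nsLH; rewrite (minJ L) ?properxx //.
    by rewrite properE sHL nsLH (subset_trans (proper_sub ltLJ)).
  exact: proper_sub.
have pJ := pgroupS sJP pP.
exists J; split=> //; [exact: p_maximal_normal pJ maxH | exact: p_maximal_index pJ maxH].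
Qed.

Lemma index2_mem_mulV (gT : finGroupType) (G H : {group gT}) x y :
    H \subset G -> #|G : H| = 2 -> x \in G -> x \notin H -> y \in G -> y \notin H ->
  y * x^-1 \in H.
Proof.
move=> sHG iH Gx nHx Gy nHy.
by rewrite -mem_rcoset (rcoset_index2 sHG iH) inE ?nHx ?nHy.
Qed.

(* Induction on #|P : H|: let H < J with #|J : H| = 2, M the core of J, C that of H, and x
   outside a maximal subgroup Y >= J. The commutators [m, x] lie in 'Phi(P), so only the
   centraliser of x in M / C matters, and this is determined by its trace on the
   conjugates of H under Y, which are at most #|Y : J| in number. *)
Lemma index_Phi_gcore (gT : finGroupType) (P H : {group gT}) :
    2.-group P -> H \subset P ->
  #|P : 'Phi(P) <*> gcore H P| <= 2 ^ (#|P : H|./2).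
Proof.
move=> pP; have [k] := ubnP #|P : H|; elim: k H => // k IHk H lek sHP.
have [sPH | nsPH] := boolP (P \subset H).
  have -> : gcore H P = P.
    apply/eqP; rewrite eqEsubset (subset_trans (gcore_sub _ _)) //.
    by rewrite gcore_max ?normG.
  have /eqP-> : #|P : 'Phi(P) <*> P| == 1%N by rewrite indexg_eq1 joing_subr.
  by rewrite expn_gt0.
have [|J [nsHJ iJH sJP]] := @subgroup_index2_step _ P H pP; first by rewrite properE sHP nsPH.
have sHJ := normal_sub nsHJ; have nHJ := normal_norm nsHJ.
have iPH := Lagrange_index sJP sHJ.
have [eqJP | [Y maxY sJY]] := maximal_exists sJP.
  have nsHP : H <| P by rewrite -eqJP.
  rewrite (_ : #|P : H| = 2) -?eqJP // expn1 -[X in _ <= X]iJH eqJP.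
  rewrite dvdn_leq ?indexg_gt0 // indexgS // (_ : gcore H P = H) ?joing_subr //.
  by apply/eqP; rewrite eqEsubset gcore_sub gcore_max ?normal_norm.
have nsYP := p_maximal_normal pP maxY; have iPY := p_maximal_index pP maxY.
have [sYP] : Y \subset P /\ ~~ (P \subset Y) by case/maxgroupP: maxY => /andP[].
case/subsetPn=> x Px nYx.
pose C : {group gT} := [group of gcore H P]; pose M : {group gT} := [group of gcore J P].
rewrite -/(gval C).
have sCM : C \subset M by apply/bigcapsP=> g Pg; rewrite (bigcap_min g) ?conjSg.
have sMJ : M \subset J by exact: gcore_sub.
have nCP : P \subset 'N(C) by exact: gcore_norm.
have nMP : P \subset 'N(M) by exact: gcore_norm.
have sMP := subset_trans sMJ sJP; have nCM := subset_trans sMP nCP.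
rewrite (@index_joing_mul _ P _ M C) ?Phi_normal //=.
have iPJ := Lagrange_index sYP sJY; rewrite iPY in iPJ.
have leJ : #|P : 'Phi(P) <*> M| <= 2 ^ #|Y : J|.
  apply: leq_trans (IHk J _ sJP) _; last by rewrite -iPJ mul2n doubleK.
  rewrite ltnS -iPH iJH muln2 -addnn in lek; apply: leq_trans lek.
  by rewrite -addn1 leq_add2l indexg_gt0.
(* [#|P : H|] is four times [#|Y : J|]: half of the exponent pays for [M], by induction, the other
   half for the passage from [M] to [C]. *)
rewrite (_ : (#|P : H|./2 = #|Y : J| + #|Y : J|)%N); last first.
  by rewrite -iPH -iPJ iJH muln2 doubleK mul2n addnn.
rewrite expnD leq_mul //.
pose W := (M :&: coset C @*^-1 'C_(M / C)[coset C x])%G.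
have sCW : C \subset W.
  by rewrite subsetI sCM -sub_quotient_pre ?normG // trivg_quotient sub1G.
have defWb : W / C = 'C_(M / C)[coset C x].
  by rewrite quotientGI // cosetpreK; apply/setIidPr/subsetIl.
have commW w : w \in W -> [~ w, x] \in C.
  case/setIP=> Mw /morphpreP[nCw /setIP[_ /cent1P cwx]].
  have nCx := subsetP nCP x Px.
  apply: coset_idr; first by rewrite groupR.
  by rewrite morphR //; apply/eqP/commgP.
have leWC : #|W : C| <= 2 ^ #|Y : J|.
  (* [J] normalises [H], so [H] has at most [#|Y : J|] conjugates under [Y]; each cuts subgroups of
     [M] in index at most 2, as [M] lies in every conjugate of [J]. *)
  pose S := [set (H :^ g)%G | g in Y].
  have leS : size (enum S) <= #|Y : J|.
    rewrite -cardE (_ : S = orbit 'JG Y H) // card_orbit astab1JG.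
    by rewrite dvdn_leq ?indexg_gt0 // indexgS // subsetI sJY.
  apply: leq_trans (leq_pexp2l _ leS) => //.
  apply: index_bigcap_leq => [A X | w Ww wS].
    rewrite mem_enum => /imsetP[g Yg ->] sXW.
    rewrite -iJH -(indexJg J H g); apply/subset_leq_card/imsetS.
    apply: subset_trans sXW _; apply: subset_trans (subsetIl _ _) _.
    by apply: bigcap_inf; apply: subsetP Yg.
  apply/bigcapP=> g Pg; have [Yg | nYg] := boolP (g \in Y).
    by apply: (wS (H :^ g)%G); rewrite mem_enum imset_f.
  (* Outside [Y], the conjugate [w ^ x] still lies in [H :^ g]; since [[~ w, x]] lies in [C], so
     does [w] lie in [H :^ g]. *)
  have Yg : g * x^-1 \in Y := (index2_mem_mulV sYP iPY Px nYx Pg nYg).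
  have: w ^ x \in H :^ g.
    have -> : H :^ g = (H :^ (g * x^-1)%g) :^ x by rewrite -conjsgM mulgKV.
    by rewrite memJ_conjg; apply: (wS (H :^ (g * x^-1)%g)%G); rewrite mem_enum imset_f.
  have: [~ w, x] \in H :^ g by apply: (bigcapP (commW w Ww)).
  by rewrite conjg_mulR => Hwx; rewrite groupMr.
apply: leq_trans leWC.
pose D := (M :&: 'Phi(P) <*> C)%G.
have sCD : C \subset D by rewrite subsetI sCM joing_subr.
have nCW : W \subset 'N(C) by apply: subset_trans (subsetIl _ _) nCM.
(* The index is the size of the class of [coset C x] under [M / C], and this class lies in one coset
   of [D / C], because the commutators of [x] with [M] lie in [M] and in ['Phi(P)]. *)
have leD : #|M / C : W / C| <= #|D / C|.
  rewrite defWb index_cent1 -(card_lcoset (D / C) (coset C x)); apply/subset_leq_card.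
  apply/subsetP=> _ /imsetP[_ /morphimP[m nCm Mm ->] ->].
  have nCx := subsetP nCP x Px; have Pm := subsetP sMP m Mm.
  rewrite mem_lcoset -commgEl -morphR // mem_quotient // inE.
  apply/andP; split; first by rewrite commgEr groupMr // memJ_norm ?groupV ?(subsetP nMP).
  apply/(subsetP (joing_subl _ _))/(subsetP (_ : P^`(1) \subset _)); last by rewrite mem_commg.
  by rewrite (Phi_joing pP) joing_subl.
have eqM : (#|W : C| * #|(M / C)%g : (W / C)%g| = #|M : D| * #|(D / C)%g|)%N.
  rewrite (card_quotient (subset_trans (subsetIl _ _) nCM)) Lagrange_index ?subsetIl //.
  by rewrite -(card_quotient nCW) Lagrange ?quotientS ?subsetIl // card_quotient.
have -> : #|M : 'Phi(P) <*> C| = #|M : D| by rewrite indexgI.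
rewrite -(leq_pmul2r (cardG_gt0 (D / C))) -eqM.
by rewrite leq_mul2l leD orbT.
Qed.

(** On one orbit the kernel is the core of a point stabiliser, so [index_Phi_gcore] applies; the
    kernel [K] then acts on the remaining points, and ['Phi(K)] lies in ['Phi(P)]. *)
Lemma index_Phi_astab (aT : finGroupType) (T : finType) (to : {action aT &-> T})
    (P : {group aT}) (S : {set T}) :
    2.-group P -> [acts P, on S | to] ->
  #|P : 'Phi(P) <*> 'C_P(S | to)| <= 2 ^ #|S|./2.
Proof.
have [k] := ubnP #|S|; elim: k P S => // k IHk P S leS pP actS.
have [-> | [x Sx]] := set_0Vmem S.
  rewrite cards0 (_ : #|_ : _| = 1%N) //; apply/eqP; rewrite indexg_eq1 sub_gen //.
  rewrite (_ : 'C_P(_ | to) = P) ?subsetUr //; apply/setIidPl/subsetP=> a _.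
  by apply/astabP=> y; rewrite inE.
pose O := orbit to P x; have sOS : O \subset S by rewrite acts_sub_orbit.
pose K := 'C_P(O | to)%G; pose R := S :\: O.
have sKP : K \subset P by exact: subsetIl.
have actR : [acts P, on R | to].
  apply/actsP=> a Pa y; rewrite !inE (acts_act actS Pa).
  by rewrite (acts_act (acts_orbit _ _ (subsetT P)) Pa).
have eqC : 'C_P(S | to) = 'C_K(R | to).
  rewrite -[in LHS](setID S O) (setIidPr sOS) astabU setIA //.
rewrite eqC (@index_joing_mul _ P _ K) ?Phi_normal ?subsetIl //=.
have -> : (#|S| = #|O| + #|R|)%N by rewrite -(cardsID O S) (setIidPr sOS).
apply: (@leq_trans (2 ^ #|O|./2 * 2 ^ #|R|./2)).
  apply: leq_mul.
    have -> : 'C_P(O | to) = gcore 'C_P[x | to] P.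
      rewrite (astab_trans_gcore (atrans_orbit to P x) (orbit_refl to P x)).
      apply/setP=> y; rewrite inE; apply/andP/bigcapP=> [[Py /bigcapP cy] g Pg | cy].
        by rewrite conjIg conjGid // inE Py cy.
      have := cy 1 (group1 P); rewrite conjsg1 => /setIP[Py _]; split=> //.
      by apply/bigcapP=> g Pg; have := cy g Pg; rewrite conjIg => /setIP[].
    by rewrite /O card_orbit index_Phi_gcore ?subsetIl.
  apply: leq_trans (IHk K R _ _ _); last 1 first.
  - exact: subset_trans sKP actR.
  - by rewrite dvdn_leq ?indexg_gt0 // indexgS // genS // setSU // (PhiS pP).
  - rewrite -ltnS (leq_trans _ leS) // ltnS proper_card //.
    by rewrite properEneq subsetDl andbT; apply: contraTneq Sx => <-; rewrite inE orbit_refl.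
  - exact: pgroupS pP.
by rewrite -expnD leq_exp2l // halfD; case: (odd _ && odd _); rewrite ?add0n ?add1n.
Qed.

(** * Elementary abelian quotients of exponent 2 *)

(** [G / K] is elementary abelian of exponent dividing 2, phrased without quotients: containing the
    derived subgroup already makes [K] normal. *)
Definition elem2_over (gT : finGroupType) (G K : {group gT}) :=
  [/\ K \subset G, G^`(1) \subset K & forall g, g \in G -> g ^+ 2 \in K].

Lemma elem2_overT (gT : finGroupType) (G : {group gT}) : elem2_over G G.
Proof. by split=> [||g Gg]; rewrite ?der_sub ?groupX. Qed.

Lemma elem2_overS (gT : finGroupType) (G K H : {group gT}) :
  elem2_over G K -> K \subset H -> H \subset G -> elem2_over G H.
Proof.
move=> [_ sdK sqK] sKH sHG; split=> [||g Gg] //; first exact: subset_trans sdK sKH.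
by rewrite (subsetP sKH) ?sqK.
Qed.

Lemma elem2_over_normal (gT : finGroupType) (G K : {group gT}) : elem2_over G K -> K <| G.
Proof. by case=> sKG sdK _; apply: sub_der1_normal. Qed.

Lemma elem2_over_Phi (gT : finGroupType) (P : {group gT}) :
  2.-group P -> elem2_over P 'Phi(P).
Proof.
move=> pP; split=> [||g Pg] /=; first exact: Phi_sub.
  by rewrite (Phi_joing pP) joing_subl.
rewrite (Phi_joing pP) (subsetP (joing_subr _ _)) //.
exact: (Mho_p_elt 1 Pg (mem_p_elt pP Pg)).
Qed.

Lemma elem2_over_index2 (gT : finGroupType) (G L : {group gT}) :
  L \subset G -> #|G : L| = 2 -> elem2_over G L.
Proof.
move=> sLG iL; have nsLG := index2_normal sLG iL; have nLG := normal_norm nsLG.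
have oGL : #|G / L| = 2 by rewrite card_quotient.
split=> // [|g Gg].
  by rewrite der1_min // cyclic_abelian // prime_cyclic // oGL.
apply: coset_idr; first by rewrite groupX // (subsetP nLG).
by rewrite morphX ?(subsetP nLG) // -oGL expg_cardG // mem_quotient.
Qed.

Lemma elem2_overI (gT : finGroupType) (G K L : {group gT}) :
  elem2_over G K -> elem2_over G L -> elem2_over G (K :&: L)%G.
Proof.
move=> [sKG sdK sqK] [sLG sdL sqL]; split=> [||g Gg].
- by rewrite subIset ?sKG.
- by rewrite subsetI sdK.
- by rewrite inE sqK ?sqL.
Qed.

Lemma elem2_over_pgroup (gT : finGroupType) (G K : {group gT}) :
  elem2_over G K -> 2.-group (G / K).
Proof.
move=> eK; have [sKG _ sqK] := eK; have nKG := normal_norm (elem2_over_normal eK).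
apply/pgroupP=> q q_pr /(Cauchy q_pr)[_ /morphimP[g nKg Gg ->] og].
have: #[coset K g] %| 2 by rewrite order_dvdn -morphX //; apply/eqP/coset_id/sqK.
by rewrite og dvdn_prime2.
Qed.

Lemma Phi_sub_elem2_over (gT : finGroupType) (G K P : {group gT}) :
  elem2_over G K -> 2.-group P -> P \subset G -> 'Phi(P) \subset K.
Proof.
move=> [sKG sdK sqK] pP sPG; rewrite (Phi_joing pP) join_subG (subset_trans (dergS 1 sPG)) //=.
rewrite (MhoE 1 pP) gen_subG; apply/subsetP=> _ /imsetP[g Pg ->].
by rewrite expn1 sqK // (subsetP sPG).
Qed.

Lemma elem2_over_card_joing_cycle (gT : finGroupType) (G K : {group gT}) g :
  elem2_over G K -> g \in G -> g \notin K -> #|K <*> <[g]>| = (2 * #|K|)%N.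
Proof.
move=> eK Gg nKg; have [sKG _ sqK] := eK; have nKG := normal_norm (elem2_over_normal eK).
have nKg' := subsetP nKG g Gg.
have og : #[coset K g] = 2.
  apply: nt_prime_order => //; first by rewrite -morphX //; apply/coset_id/sqK.
  by apply: contra nKg => /eqP/coset_idr->.
have nKj : K <*> <[g]> \subset 'N(K) by rewrite join_subG normG cycle_subG.
by rewrite -(Lagrange (joing_subl K <[g]>)) -card_quotient // quotientYidl ?cycle_subG //
  quotient_cycle // -orderE og mulnC.
Qed.

(* A complemented chief factor U / V of order 2 has a complement L of index 2 in G
   with V <= L and ~ (U <= L), so the successive complements are independent. *)
Lemma alpha21_elem2_over (gT : finGroupType) (G : {group gT}) (s : seq {group gT}) :
  chief_series G s ->
  exists2 K : {group gT}, elem2_over G K & #|G : K| = (2 ^ alpha21_of G s)%N.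
Proof.
rewrite /chief_series /alpha21_of; move: (1%G : {group gT}) => V [].
(* The series may start at any [V], with [V \subset K] as invariant: from [U \subset K] and
   [L * U = G] follows [L * K = G], so that intersecting [K] with [L] exactly doubles the index. *)
suff IH : forall V : {group gT}, path.path (fun V U : {group gT} => chief_factor G V U) V s ->
    last V s = G -> exists K : {group gT}, [/\ elem2_over G K, V \subset K &
    #|G : K| = (2 ^ count (fun p : {group gT} * {group gT} =>
           (#|p.2 : p.1| == 2)%N && complemented_factor G p.1 p.2) (zip (V :: s) s))%N].
  by move=> pV lV; have [K [eK _ iK]] := IH V pV lV; exists K.
elim: s {V} => [|U s IHs] V /=.
  by move=> _ ->; exists G; rewrite indexgg; split=> //; apply: elem2_overT.
case/andP=> /andP[/maxgroupP[/andP[/andP[sVU _] _] _] _] /IHs{IHs}IHs /IHs[K [eK sUK iK]].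
case: (boolP ((#|U : V| == 2)%N && complemented_factor G V U)) => [|_]; last first.
  by exists K; split=> //; apply: subset_trans sUK.
case/andP=> /eqP iUV /existsP[L /and3P[sLG /eqP tiLU /eqP defG]].
have iL : #|G : L| = 2 by rewrite -defG indexMg -indexgI setIC tiLU.
exists (K :&: L)%G; split; first exact: elem2_overI (elem2_over_index2 sLG iL).
  by rewrite subsetI (subset_trans sVU) // -tiLU subsetIl.
have [sKG _ _] := eK.
rewrite -(Lagrange_index sKG (subsetIl K L)) indexgI iK.
have -> : #|K : L| = #|G : L|.
  rewrite -indexMg (_ : L * K = G) //; apply/eqP; rewrite eqEsubset mul_subG //=.
  by rewrite -{1}defG mulgS.
by rewrite iL add1n expnSr.
Qed.

(** * 2-groups of maximal rank normalising a subgroup of odd order *)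

Lemma half_sub_leq a b : 0 < a -> a <= b -> b./2 <= (b - a)./2 -> a = 1%N /\ odd b.
Proof. lia. Qed.

Lemma orbit_aperm_norm (T : finType) (E : {group {perm T}}) (l : {perm T}) x y :
  l \in 'N(E) -> y \in orbit 'P E x -> l y \in orbit 'P E (l x).
Proof.
move=> nEl /orbitP[e Ee <-]; apply/orbitP; exists (e ^ l); first by rewrite memJ_norm.
by rewrite /= !apermE -!permM conjgE !mulgA mulgV mul1g.
Qed.

Lemma index2_leq (gT : finGroupType) (Z K : {group gT}) :
    (forall g h, g \in Z -> h \in Z -> g \notin K -> h \notin K -> g * h^-1 \in K) ->
  #|Z : K| <= 2.
Proof.
move=> ZK; have [sZK | /subsetPn[h Zh nKh]] := boolP (Z \subset K).
  by have /eqP-> : #|Z : K| == 1%N by rewrite indexg_eq1.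
apply: leq_trans (_ : #|[set (K : {set gT}); K :* h]| <= _); last by rewrite cards2; case: (_ != _).
apply: subset_leq_card; apply/subsetP=> _ /rcosetsP[g Zg ->]; rewrite !inE.
have [Kg | nKg] := boolP (g \in K); first by rewrite rcoset_id ?eqxx.
by apply/orP; right; apply/eqP/rcoset_eqP; rewrite mem_rcoset ZK.
Qed.

(** If [g] moves [a] and fixes [e], then [a * e] goes to [a^-1 * e], which must be [a * e] or
    [a^-1 * e^-1]; the first contradicts the choice of [a], the second says that [e] is its own
    inverse. *)
Lemma abelian_pair_norm (gT : finGroupType) (E : {group gT}) g :
    abelian E -> (forall e, e \in E -> e ^ g \in [set e; e^-1]) ->
  g \in 'C(E) \/ forall e, e \in E -> e ^ g = e^-1.
Proof.
move=> abE pairE.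
have [cE | /forall_inPn[a Ea nCa]] := boolP [forall e in E, e ^ g == e].
  left; apply/centP=> e Ee.
  by apply/commute_sym/commgP/conjg_fixP/eqP/(forall_inP cE).
right=> e Ee; have := pairE e Ee; rewrite !inE => /orP[/eqP eg | /eqP //].
have := pairE a Ea; rewrite !inE (negPf nCa) /= => /eqP ag.
have := pairE (a * e) (groupM Ea Ee); rewrite conjMg ag eg !inE => /orP[] /eqP.
  by move/mulIg=> aV; rewrite ag aV eqxx in nCa.
have -> : (a * e)^-1 = a^-1 * e^-1 by rewrite -invMg (centsP abE a Ea e Ee).
by move/mulgI.
Qed.

(** By the Frattini argument the index of the normaliser of a Sylow subgroup of [N] divides [#|N|],
    hence is prime to [p]; so this normaliser contains a conjugate of [Q]. *)
Lemma Sylow_normalized (gT : finGroupType) (G N Q : {group gT}) p q :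
    p.-Sylow(G) Q -> N <| G -> p^'.-group N ->
  exists2 S : {group gT}, q.-Sylow(N) S & Q \subset 'N(S).
Proof.
move=> sylQ nsNG p'N; have [S sylS] := Sylow_exists q N.
have defG := Frattini_arg nsNG sylS.
have [R sylR] := Sylow_exists p 'N_G(S).
have sylRG : p.-Sylow(G) R.
  case/and3P: sylR => sRN pR p'R; apply/and3P; split=> //.
    exact: subset_trans sRN (subsetIl _ _).
  rewrite -(Lagrange_index (subsetIl G 'N(S)) sRN) pnatM p'R andbT.
  rewrite -{1}defG -normC ?indexMg; last exact: subset_trans (subsetIl _ _) (normal_norm nsNG).
  exact: pnat_dvd (dvdn_indexg _ _) p'N.
have [x Gx ->] := Sylow_trans sylRG sylQ.
exists (S :^ x)%G.
  by rewrite -(normsP (normal_norm nsNG) x Gx) pHallJ2.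
rewrite normJ conjSg; case/and3P: sylR => sRN _ _.
exact: subset_trans sRN (subsetIr _ _).
Qed.

(** For odd [t] and [r] the inequality reads [u <= u./2 + 1], that is [u <= 2], where
    [r = 2 * u + 1]. *)
Lemma half_bound u t r :
    (u * 2)%N = r.-1 -> odd t -> odd r -> r <= t -> 1 < r ->
  t./2 <= u./2 + 1 + (t - r)./2 -> r = 3 \/ r = 5.
Proof. lia. Qed.

Section ExtremalTwoGroup.

Variables (T : finType) (P : {group {perm T}}).
Hypotheses (pP : 2.-group P) (iP : #|P : 'Phi(P)| = (2 ^ #|T|./2)%N).

Lemma extremal_faithful_card (S : {set T}) :
  [acts P, on S | 'P] -> 'C_P(S | 'P) = 1 -> #|T|./2 <= #|S|./2.
Proof.
move=> actS C1; have := index_Phi_astab pP actS.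
by rewrite C1 joingG1 iP leq_exp2l.
Qed.

(** Two fixed points could both be dropped: [P] would stay faithful on [#|T| - 2] points, and half
    the degree would decrease by one. *)
Lemma extremal_fix_uniq x y :
  (forall g, g \in P -> g x = x) -> (forall g, g \in P -> g y = y) -> x = y.
Proof.
move=> Px Py; apply/eqP; apply: contraT => neq_xy.
have actS : [acts P, on ~: [set x; y] | 'P].
  apply/actsP=> g Pg z; rewrite !inE /= apermE.
  by rewrite -{1}(Px g Pg) -{1}(Py g Pg) !(inj_eq perm_inj).
have le2 : 2 <= #|T|.
  have <- : #|[set x; y]| = 2 by rewrite cards2 neq_xy.
  exact: max_card.
have := extremal_faithful_card actS; rewrite cardsCs setCK cards2 neq_xy.
suff -> : 'C_P(~: [set x; y] | 'P) = 1.
  move/(_ erefl); move: le2.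
  by case: #|T| => [|[|m]] // _; rewrite subSS subSS subn0 /= ltnn.
apply/trivgP/subsetP=> g /setIP[Pg /astabP fixg]; apply/set1P/permP=> z; rewrite perm1.
have [-> | neq_zx] := eqVneq z x; first exact: Px.
have [-> | neq_zy] := eqVneq z y; first exact: Py.
by have := fixg z; rewrite !inE negb_or neq_zx neq_zy => /(_ isT).
Qed.

(* The stabiliser in P of a nontrivial orbit B of E fixes some y in B, as #|B| is odd;
   then the P-orbit of y meets each of its E-orbits only once, so P is faithful off it. *)
Lemma extremal_fix_orbit (E : {group {perm T}}) x :
    odd #|E| -> P \subset 'N(E) -> orbit 'P E x != [set x] ->
  odd #|T| /\ exists2 y, y \in orbit 'P E x & forall g, g \in P -> g y = y.
Proof.
move=> oddE nEP ntB; set B := orbit 'P E x.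
have oddB : odd #|B| by rewrite card_orbit (dvdn_odd (dvdn_indexg _ _)).
have act_stab : [acts 'N_P(B | 'P), on B | 'P] by apply: subsetIr.
have := pgroup_fix_mod (pgroupS (subsetIl P 'N(B | 'P)) pP) act_stab.
rewrite !modn2 oddB => /esym odd_fix.
have [y /setIP[By /afixP fixy]] : exists y, y \in 'Fix_(B | 'P)('N_P(B | 'P)).
  apply/set0Pn; apply: contraTneq (isT : true) => F0; by rewrite F0 cards0 in odd_fix.
have orbB z : z \in B -> orbit 'P E z = B by move/orbit_eqP.
(* [P] permutes the orbits of [E], so an element sending [y] into [B] stabilises [B], and the
   stabiliser of [B] fixes [y]. *)
have meet1 l : l \in P -> l y \in B -> l y = y.
  move=> Pl Bly; have /fixy : l \in 'N_P(B | 'P); last by [].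
  rewrite inE Pl; apply/astabsP=> z; rewrite /= apermE.
  have nEl := subsetP nEP l Pl.
  rewrite -{1}(orbB _ Bly) -(orbB y By); apply/idP/idP; last exact: orbit_aperm_norm.
  by move/(orbit_aperm_norm (groupVr nEl)); rewrite -!permM !mulgV !perm1.
pose D := orbit 'P P y.
have meetD z z' : z \in D -> z' \in D -> z' \in orbit 'P E z -> z' = z.
  case/orbitP=> h Ph <- /orbitP[k Pk <-]; rewrite /= !apermE => Ekh.
  have Phk : k * h^-1 \in P by rewrite groupM ?groupV.
  have nEh : h^-1 \in 'N(E) by rewrite groupV (subsetP nEP).
  have := meet1 _ Phk; rewrite permM -(orbB y By).
  have := orbit_aperm_norm nEh Ekh; rewrite -[h^-1 (h y)]permM mulgV perm1 => Ey /(_ Ey).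
  by move/(congr1 h); rewrite permKV.
have actD : [acts P, on ~: D | 'P].
  by apply/actsP=> g Pg z; rewrite !inE (acts_act (acts_orbit 'P y (subsetT P)) Pg).
have CD : 'C_P(~: D | 'P) = 1.
  apply/trivgP/subsetP=> g /setIP[Pg /astabP fixg]; apply/set1P/permP=> z; rewrite perm1.
  have fixgD z' : z' \notin D -> g z' = z' by move=> nDz'; apply: fixg; rewrite inE.
  have [Dz | /fixgD //] := boolP (z \in D).
  (* The [E]-orbit of [z] has another point [z'], which lies outside [D] and is fixed by [g]; so
     [g z] is in this orbit as well as in [D], and must be [z]. *)
  have [z' Ez' neq_z'] : exists2 z', z' \in orbit 'P E z & z' != z.
    have [w Bw neq_wy] : exists2 w, w \in B & w != y.
      apply/exists_inP; apply: contraR ntB; rewrite negb_exists_in => /forall_inP B1.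
      have eqy w : w \in B -> w = y by move/B1; rewrite negbK => /eqP.
      rewrite eqEsubset sub1set orbit_refl andbT; apply/subsetP=> w Bw.
      by rewrite (eqy w Bw) -(eqy x) ?set11 ?orbit_refl.
    case/orbitP: Dz => h Ph <-; exists (h w); last by rewrite /= apermE (inj_eq perm_inj).
    by apply: orbit_aperm_norm; rewrite ?(subsetP nEP) // (orbB y By).
  have nDz' : z' \notin D by apply: contra neq_z' => Dz'; rewrite (meetD z z').
  apply: meetD => //; first by rewrite (acts_act (acts_orbit 'P y (subsetT P)) Pg).
  have nEg := subsetP nEP g Pg; have Ezz' : z \in orbit 'P E z' by rewrite orbit_sym.
  have := orbit_aperm_norm nEg Ezz'; rewrite (fixgD _ nDz') => Egz.
  by rewrite (orbit_trans Egz).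
have := extremal_faithful_card actD CD; rewrite cardsCs setCK => leD.
have D_gt0 : 0 < #|D| by apply/card_gt0P; exists y; apply: orbit_refl.
have leDT : #|D| <= #|T| by exact: max_card.
have [D1 oddT] : #|D| = 1%N /\ odd #|T|.
  exact: half_sub_leq D_gt0 leDT leD.
split=> //; exists y => // g Pg.
by have := mem_orbit 'P y Pg; rewrite (card_orbit1 D1) => /set1P.
Qed.

(** Every nontrivial orbit of [E] contains a point fixed by [P], and [P] fixes at most one point, so
    there is only one such orbit. *)
Lemma extremal_odd_orbit (E : {group {perm T}}) :
    odd #|E| -> P \subset 'N(E) -> E :!=: 1 ->
  odd #|T| /\ exists y, (forall g, g \in P -> g y = y) /\
    (forall e x, e \in E -> x \notin orbit 'P E y -> e x = x).
Proof.
move=> oddE nEP ntE.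
have [x ntx] : exists x, orbit 'P E x != [set x].
  apply/existsP; apply: contraR ntE; rewrite negb_exists => /forallP triv.
  apply/eqP/trivgP/subsetP=> e Ee; apply/set1P/permP=> x; rewrite perm1.
  by have := mem_orbit 'P x Ee; have:= triv x; rewrite negbK => /eqP-> /set1P.
have [oddT [y Ey fixy]] := extremal_fix_orbit oddE nEP ntx.
split=> //; exists y; split=> // e z Ee nEz.
have [triv | ntz] := eqVneq (orbit 'P E z) [set z].
  by have := mem_orbit 'P z Ee; rewrite triv => /set1P.
have [_ [y' Ey' fixy']] := extremal_fix_orbit oddE nEP ntz.
by rewrite -(extremal_fix_uniq fixy' fixy) orbit_sym Ey' in nEz.
Qed.

(* P permutes the (#|E| - 1) / 2 pairs {e, e^-1} with kernel acting on E by inversion at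
   most, while 'C_P(E) is faithful off the unique nontrivial orbit of E. This leaves
   #|E| = 3 or 5, and in the last case Aut E is cyclic. *)
Lemma extremal_abelian_card (E : {group {perm T}}) :
  odd #|E| -> P \subset 'N(E) -> E :!=: 1 -> abelian E -> #|E| = 3.
Proof.
move=> oddE nEP ntE abE.
have [oddT [y [fixy offE]]] := extremal_odd_orbit oddE nEP ntE.
set B := orbit 'P E y in offE.
(* The stabiliser of [y] in the abelian group [E] fixes the whole orbit [B], and [E] moves nothing
   off [B]; so [E] is regular on [B]. *)
have regE e : e \in E -> e y = y -> e = 1.
  move=> Ee ey; apply/permP=> x; rewrite perm1.
  have [/orbitP[f Ef <-] | nBx] := boolP (x \in B); last exact: offE.
  by rewrite /= apermE -permM -(centsP abE e Ee f Ef) permM ey.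
have cardB : #|B| = #|E|.
  rewrite card_orbit -indexgI (_ : E :&: 'C_E[y | 'P] = 1) ?indexg1 //.
  apply/trivgP/subsetP=> e /setIP[Ee /setIP[_ /astab1P ey]].
  by apply/set1P/regE.
have actB : [acts P, on ~: B | 'P].
  apply/actsP=> g Pg x; rewrite !inE /= apermE; congr (~~ _).
  have nEg := subsetP nEP g Pg.
  apply/idP/idP=> [/(orbit_aperm_norm (groupVr nEg)) | /(orbit_aperm_norm nEg)].
    by rewrite -{1}(fixy g Pg) !permK.
  by rewrite fixy.
pose K := 'C_P(E)%G; have sKP : K \subset P by apply: subsetIl.
(* An element of [K] that is trivial off [B] fixes [y] and commutes with [E], hence fixes [B]
   pointwise. *)
have leK : #|K : 'Phi(K)| <= 2 ^ (#|T| - #|E|)./2.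
  have CB : #|~: B| = (#|T| - #|E|)%N by rewrite cardsCs setCK cardB.
  have := index_Phi_astab (pgroupS sKP pP) (subset_trans sKP actB).
  suff -> : 'C_K(~: B | 'P) = 1 by rewrite joingG1 CB.
  apply/trivgP/subsetP=> g /setIP[/setIP[Pg /centP cEg] /astabP fixg].
  apply/set1P/permP=> x; rewrite perm1.
  have [/orbitP[f Ef <-] | nBx] := boolP (x \in B); last by apply: fixg; rewrite inE.
  by rewrite /= apermE -permM -(cEg f Ef) permM fixy.
have leET : #|E| <= #|T| by rewrite -cardB; exact: max_card.
have leP (Z : {group {perm T}}) : K \subset Z -> Z \subset P ->
    2 ^ #|T|./2 <= #|P : 'Phi(P) <*> Z| * #|Z : K| * 2 ^ (#|T| - #|E|)./2.
  move=> sKZ sZP; rewrite -iP -{1}(joingG1 'Phi(P)) (index_joing_mul (Phi_normal P) sZP (sub1G Z)).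
  rewrite joingG1 -mulnA leq_mul2l; apply/orP; right.
  apply: leq_trans (leq_mul (leqnn #|Z : K|) leK).
  rewrite (Lagrange_index sKZ (Phi_sub K)) dvdn_leq ?indexg_gt0 // indexgS //.
  exact: PhiS pP sKP.
pose U := [set [set e; e^-1] | e in E^#].
have invE (e : {perm T}) : e \in E^# -> e^-1 != e.
  case/setD1P=> nt_e Ee; apply: contra nt_e => /eqP eV.
  have: #[e] %| 2 by rewrite order_dvdn expgS expg1 -{1}eV mulVg.
  have odde : odd #[e] by apply: dvdn_odd oddE; apply: order_dvdG.
  have /primeP[_ p2] : prime 2 by [].
  by case/p2/orP=> /eqP oe; [rewrite -order_eq1 oe | rewrite oe in odde].
have VE (e : {perm T}) : e \in E^# -> e^-1 \in E^# by rewrite !inE invg_eq1 groupV.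
have cardU : (#|U| * 2 = #|E|.-1)%N.
  rewrite (cardsD1 1 E) group1 /=; symmetry; apply: card_uniform_partition.
    by move=> _ /imsetP[e /invE neV ->]; rewrite cards2 eq_sym neV.
  apply/and3P; split.
  - rewrite eqEsubset; apply/andP; split; apply/subsetP=> e.
      by case/bigcupP=> _ /imsetP[f Ef ->]; rewrite in_set2 => /orP[] /eqP-> //; apply: VE.
    by move=> Ee; apply/bigcupP; exists [set e; e^-1]; [apply: imset_f | apply: set21].
  - apply/trivIsetP=> _ _ /imsetP[e Ee ->] /imsetP[f Ef ->]; apply: contraR.
    case/pred0Pn=> x; rewrite !inE => /andP[].
    move=> /orP[] /eqP-> /orP[] /eqP.
    + by move->.
    + by move->; rewrite invgK setUC.
    + by move<-; rewrite invgK setUC.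
    + by move/invg_inj->.
  - by apply/imsetP=> [[e _ /setP/(_ e)]]; rewrite !inE eqxx.
have conjU (g e : {perm T}) : [set e; e^-1] :^ g = [set e ^ g; (e ^ g)^-1].
  by rewrite conjUg !conjg_set1 conjVg.
have actU : [acts P, on U | 'Js].
  apply/subsetP=> g Pg; rewrite !inE /=; apply/subsetP=> _ /imsetP[e /setD1P[nt_e Ee] ->].
  rewrite inE /= conjU; apply: (imset_f (fun e : {perm T} => [set e; e^-1])).
  rewrite !inE conjg_eq1 nt_e memJ_norm //.
  exact: (subsetP nEP).
pose Z := 'C_P(U | 'Js)%G; have sZP : Z \subset P by apply: subsetIl.
have sKZ : K \subset Z.
  apply/subsetP=> g /setIP[Pg /centP cEg]; rewrite inE Pg.
  apply/astabP=> _ /imsetP[e /setD1P[_ Ee] ->].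
  by rewrite /= conjU /conjg -(cEg e Ee) mulKg.
have pairZ g e : g \in Z -> e \in E -> e ^ g \in [set e; e^-1].
  case/setIP=> _ /astabP fixg Ee; have [-> | nt_e] := eqVneq e 1; first by rewrite conj1g set21.
  have Ue : [set e; e^-1] \in U by apply: imset_f; rewrite !inE nt_e.
  by have /= <- := fixg _ Ue; rewrite conjU set21.
have leZK : #|Z : K| <= 2.
  have invZ g : g \in Z -> g \notin K -> forall e, e \in E -> e ^ g = e^-1.
    move=> Zg nKg; case: (abelian_pair_norm abE (fun e => pairZ g e Zg)) => // cEg.
    by rewrite inE (subsetP sZP) // cEg in nKg.
  apply: index2_leq => g h Zg Zh nKg nKh; rewrite inE groupM ?groupV ?(subsetP sZP) //=.
  apply/centP=> e Ee; apply/commute_sym/commgP/conjg_fixP.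
  have eh : e ^ h^-1 = e^-1.
    by apply: (conjg_inj h); rewrite conjgKV conjVg (invZ h Zh nKh e Ee) invgK.
  by rewrite conjgM (invZ g) // conjVg eh invgK.
have leU := index_Phi_astab pP actU.
have E_gt1 : 1 < #|E| by rewrite cardG_gt1.
have [//| E5] : #|E| = 3 \/ #|E| = 5.
  have: 2 ^ #|T|./2 <= 2 ^ (#|U|./2 + 1 + (#|T| - #|E|)./2).
    apply: leq_trans (leP Z sKZ sZP) _; rewrite !expnD expn1 leq_mul2r.
    by apply/orP; right; apply: leq_mul.
  rewrite leq_exp2l //; move: cardU oddT oddE leET E_gt1.
  move: #|U| #|T| #|E| => u t r; exact: half_bound.
(* For order 5, [P / K] embeds in a cyclic group and contributes a factor of at most 2, but
   [#|T|./2 <= 1 + (#|T| - 5)./2] fails for odd [#|T|]. *)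
have := leP K (subxx K) sKP; rewrite indexgg muln1.
suff leP2 : #|P : 'Phi(P) <*> K| <= 2.
  move=> /leq_trans/(_ (leq_mul leP2 (leqnn _))); rewrite -expnS leq_exp2l // E5.
  by move: oddT leET; rewrite E5; move: #|T| => t; lia.
have cycA : cyclic (Aut E) by apply: Aut_prime_cyclic; rewrite E5.
have /cyclicP[a defa] : cyclic (conj_aut E @* P).
  by apply: cyclicS cycA; apply: subset_trans (morphimS _ nEP) _; rewrite Aut_conj_aut.
have /morphimP[x nEx Px def_a] : a \in conj_aut E @* P by rewrite defa cycle_id.
have genP : P \subset 'Phi(P) <*> K <*> <[x]>.
  apply/subsetP=> g Pg; have nEg := subsetP nEP g Pg.
  have: conj_aut E g \in <[a]> by rewrite -defa mem_morphim.
  case/cycleP=> i; rewrite def_a -morphX // => eq_gx.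
  have Kgx : g * x ^- i \in K.
    rewrite inE groupM ?groupV ?groupX //= -ker_conj_aut; apply/kerP.
      by rewrite groupM ?groupV ?groupX.
    by rewrite morphM ?groupV ?groupX // morphV ?groupX // [X in X * _]eq_gx mulgV.
  rewrite -(mulgKV (x ^+ i) g) groupM //.
    by rewrite (subsetP (joing_subl _ _)) // (subsetP (joing_subr _ _)).
  by rewrite (subsetP (joing_subr _ _)) // mem_cycle.
have eF : elem2_over P ('Phi(P) <*> K)%G.
  apply: elem2_overS (elem2_over_Phi pP) (joing_subl _ _) _.
  by rewrite join_subG Phi_sub.
have [sFP _ _] := eF.
have [Fx | nFx] := boolP (x \in 'Phi(P) <*> K).
  have /eqP-> // : #|P : 'Phi(P) <*> K| == 1%N.
  by rewrite indexg_eq1; apply: subset_trans genP _; rewrite join_subG subxx cycle_subG.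
have := elem2_over_card_joing_cycle eF Px nFx => oF.
rewrite -divgS // leq_divLR ?cardSg // -oF; exact: subset_leq_card.
Qed.

(** The abelian case, applied to centers of [P]-invariant Sylow subgroups of [N], makes [N] a
    3-group with center of order 3. This center is transitive on the only nontrivial orbit of [N],
    so [N] is regular there. *)
Lemma extremal_complement_card (G N : {group {perm T}}) :
  2.-Sylow(G) P -> N <| G -> odd #|N| -> N :!=: 1 -> #|N| = 3.
Proof.
move=> sylP nsNG oddN ntN; have nNG := normal_norm nsNG.
have nNP := subset_trans (pHall_sub sylP) nNG.
have p'N : 2^'.-group N by rewrite /pgroup p'natE // dvdn2 negbK.
have card_center q (S : {group {perm T}}) :
    q.-Sylow(N) S -> P \subset 'N(S) -> S :!=: 1 -> #|'Z(S)| = 3.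
  move=> sylS nSP ntS; apply: extremal_abelian_card.
  - by apply: dvdn_odd oddN; apply: cardSg (subset_trans (center_sub S) (pHall_sub sylS)).
  - exact: char_norm_trans (center_char S) nSP.
  - by rewrite center_nil_eq1 // (pgroup_nil (pHall_pgroup sylS)).
  - exact: center_abelian.
have N3 : 3.-group N.
  apply/pgroupP=> q q_pr qN.
  have [S sylS nSP] := Sylow_normalized q sylP nsNG p'N.
  have ntS : S :!=: 1.
    rewrite -cardG_gt1 (card_Hall sylS) p_part_gt1.
    by rewrite mem_primes q_pr cardG_gt0.
  have oZ := card_center q S sylS nSP ntS.
  have: q.-nat 3.
    by rewrite -oZ -[_.-nat _]/(q.-group 'Z(S)) (pgroupS (center_sub S)) ?(pHall_pgroup sylS).
  by rewrite pnatE // !inE eq_sym.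
have sylN : 3.-Sylow(N) N by rewrite pHallE subxx /= (part_pnat_id (N3 : 3.-nat #|N|)).
have oZ := card_center 3 N sylN nNP ntN.
have sZN := center_sub N; have nZP := char_norm_trans (center_char N) nNP.
have ntZ : 'Z(N) != 1 by rewrite -cardG_gt1 oZ.
have oddZ : odd #|'Z(N)| by rewrite oZ.
have [_ [y0 [fix0 off0]]] := extremal_odd_orbit oddN nNP ntN.
have [_ [y [fixy offy]]] := extremal_odd_orbit oddZ nZP ntZ.
rewrite (extremal_fix_uniq fix0 fixy) {y0 fix0} in off0.
have nfixZ : exists2 e, e \in 'Z(N) & e y != y.
  apply/exists_inP; apply: contraR ntZ; rewrite negb_exists_in => /forall_inP fixZ.
  have orb1 : orbit 'P 'Z(N) y = [set y].
    apply/eqP; rewrite eqEsubset sub1set orbit_refl andbT.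
    by apply/subsetP=> _ /orbitP[e /fixZ /negPn/eqP ey <-]; apply/set1P.
  apply/eqP/trivgP/subsetP=> e Ze; apply/set1P/permP=> x; rewrite perm1.
  have [-> | neq_xy] := eqVneq x y; first by have /negPn/eqP := fixZ e Ze.
  by apply: offy => //; rewrite orb1 inE.
have cZ m e : m \in N -> e \in 'Z(N) -> m * e = e * m.
  by move=> Nm /centerP[_ cN]; rewrite cN.
(* If [m y] were outside the orbit of ['Z(N)], then [e] would fix [m y] and, commuting with [m],
   also [y]. *)
have sub_orb : orbit 'P N y \subset orbit 'P 'Z(N) y.
  apply/subsetP=> _ /orbitP[m Nm <-]; rewrite /= apermE; apply: contraT => nZmy.
  have [e Ze] := nfixZ; have := offy e (m y) Ze nZmy.
  by rewrite -permM cZ // permM => /perm_inj->; rewrite eqxx.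
have C1 : 'C_N[y | 'P] = 1.
  apply/trivgP/subsetP=> m /setIP[Nm /astab1P /= my]; rewrite /= apermE in my.
  apply/set1P/permP=> x; rewrite perm1.
  have [/(subsetP sub_orb)/orbitP[e Ze <-] | nNx] := boolP (x \in orbit 'P N y); last exact: off0.
  by rewrite /= apermE -permM -cZ // permM my.
have := card_orbit 'P N y; rewrite C1 indexg1 => oN.
apply/eqP; rewrite eqn_leq -{2}oZ subset_leq_card ?sZN // andbT -oN.
apply: leq_trans (subset_leq_card sub_orb) _; rewrite card_orbit -oZ.
by rewrite dvdn_leq ?cardG_gt0 // dvdn_indexg.
Qed.

End ExtremalTwoGroup.

(** * Normal p-complements *)

Lemma Sylow_mul_normal (gT : finGroupType) p (G P N : {group gT}) :
  p.-Sylow(G) P -> N <| G -> p.-group (G / N) -> N * P = G.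
Proof.
move=> sylP /andP[sNG nNG] pGN.
have sPG := pHall_sub sylP; have nNP := subset_trans sPG nNG.
apply/eqP; rewrite eqEsubset mul_subG //= -quotientSK //.
by rewrite (pHall_id (quotient_pHall nNP sylP) pGN).
Qed.

(* Tate's theorem. Let N be a minimal normal subgroup of p-power index inside K,
   Q = P :&: N and R = Q'. The group of pairs (g, xR) with gN = xN is an
   extension of G by Q / R which splits over P, hence splits by Gaschutz;
   as Q <= 'Phi(P), the complement gives a surjection G -> P / R, and the minimality
   of N forces Q = R. *)
Theorem Tate_Phi_complement (gT : finGroupType) p (G P K : {group gT}) :
    p.-Sylow(G) P -> K <| G -> p.-group (G / K) -> P :&: K \subset 'Phi(P) ->
  exists N : {group gT}, [/\ N <| G, p^'.-group N & N * P = G].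
Proof.
move=> sylP nsKG pGK sPK.
have [|N /mingroupP[/and3P[nsNG pGN sNK] minN]] := @ex_mingroup _
    (fun N : {group gT} => [&& N <| G, p.-group (G / N) & N \subset K]).
  by exists K; rewrite nsKG pGK subxx.
have [sPG pP _] := and3P sylP; have sNG := normal_sub nsNG; have nNG := normal_norm nsNG.
have defG := Sylow_mul_normal sylP nsNG pGN.
exists N; split=> //.
pose Q := (P :&: N)%G.
have nsQP : Q <| P := normalGI sPG nsNG.
have sQP := normal_sub nsQP.
pose R := Q^`(1)%G.
have nsRP : R <| P := char_normal_trans (der_char 1 Q) nsQP.
have sRQ : R \subset Q := der_sub 1 Q.
have sQPhi : Q \subset 'Phi(P) by apply: subset_trans sPK; rewrite setIS.
have nRP := normal_norm nsRP.
(* Equal indices make the solvable group [Q] equal to its derived subgroup, hence trivial, so that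
   [N] has order prime to [p]. *)
suff eqQR : #|P : Q| = #|P : R|.
  have Q1 : Q :=: 1.
    apply/eqP; apply: contraT => ntQ.
    have := sol_der1_proper (pgroup_sol (pgroupS sQP pP)) (subxx Q) ntQ.
    case/andP=> _ /negP[]; rewrite -indexg_eq1.
    have := Lagrange_index sQP sRQ; rewrite eqQR => /eqP.
    by rewrite -[X in _ == X]muln1 eqn_pmul2l ?indexg_gt0.
  have := card_Hall (Sylow_setI_normal nsNG sylP).
  by rewrite /= setIC -[P :&: N]/(gval Q) Q1 cards1 => /esym/eqP; rewrite partn_eq1.
pose inE2 (z : gT * coset_of R) :=
  [exists x in P, (z.2 == coset R x) && (z.1 * x^-1 \in N)].
have gE : group_set [set z | (z.1 \in G) && inE2 z].
  apply/group_setP; split.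
    rewrite inE group1; apply/existsP; exists 1.
    by rewrite !group1 /= invg1 mulg1 group1 morph1 eqxx.
  move=> z t; rewrite !inE => /andP[Gz /existsP[x /and3P[Px /eqP zx Nx]]].
  case/andP=> Gt /existsP[y /and3P[Py /eqP ty Ny]].
  have eqz : z.1 * t.1 * (x * y)^-1 = z.1 * x^-1 * (t.1 * y^-1) ^ x^-1.
    by rewrite conjgE invgK invMg !mulgA mulgKV.
  rewrite fst_morphM groupM //; apply/existsP; exists (x * y).
  apply/and3P; split; first exact: groupM.
    by rewrite snd_morphM zx ty morphM ?(subsetP nRP).
  by rewrite fst_morphM eqz groupM // memJ_norm // groupV (subsetP nNG) // (subsetP sPG).
pose E := Group gE.
have EP z : reflect
    (z.1 \in G /\ exists2 x, x \in P & z.2 = coset R x /\ z.1 * x^-1 \in N) (z \in E).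
  rewrite inE; apply: (iffP andP) => [[Gz /existsP[x /and3P[Px /eqP zx Nx]]] | [Gz [x Px [zx Nx]]]].
    by split=> //; exists x.
  by split=> //; apply/existsP; exists x; rewrite Px zx eqxx.
pose f1 := @fst_morphism gT (coset_of R); pose f2 := @snd_morphism gT (coset_of R).
have imE : f1 @* E = G.
  apply/setP=> g; apply/morphimP/idP=> [[z _ /EP[Gz _] -> //] | Gg].
  have: g \in N * P by rewrite defG.
  case/mulsgP=> n x Nn Px eq_g; exists (g, coset R x) => //.
  by apply/EP; split=> //; exists x => //; split=> //=; rewrite eq_g mulgK.
pose A := 'ker_E f1%G; have nsAE : A <| E by apply: normalGI (subsetT E) (ker_normal f1).
have AP z : z \in A -> exists2 q, q \in Q & z = (1, coset R q).
  case/setIP=> /EP[_ [x Px [zx Nx]]] /mker z1; rewrite /= in z1; rewrite z1 mul1g groupV in Nx.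
  by exists x; [rewrite inE Px | rewrite [z]surjective_pairing z1 zx].
have sAX : A \subset pair1g_morphism gT (coset_of R) @* (Q / R).
  apply/subsetP=> z /AP[q Qq ->]; apply: (mem_morphim (pair1g_morphism gT (coset_of R))).
    by rewrite inE.
  by rewrite mem_quotient.
have abA : abelian A by apply: abelianS sAX (morphim_abelian _ (sub_der1_abelian (subxx _))).
have pA : p.-group A by apply: pgroupS sAX (morphim_pgroup _ (quotient_pgroup _ (pgroupS sQP pP))).
(* The graph of [P -> P / R] will be the complement of [A] in the preimage [Ph] of [P]. *)
have gD : group_set [set (x, coset R x) | x in P].
  apply/group_setP; split; first by apply/imsetP; exists 1; rewrite ?group1 ?morph1.
  move=> _ _ /imsetP[x Px ->] /imsetP[y Py ->]; apply/imsetP; exists (x * y); first exact: groupM.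
  by rewrite morphM ?(subsetP nRP).
pose D := Group gD.
have sDE : D \subset E.
  apply/subsetP=> _ /imsetP[x Px ->]; apply/EP; split; first exact: (subsetP sPG).
  by exists x => //=; rewrite mulgV group1.
pose Ph := (E :&: f1 @*^-1 P)%G.
have sAPh : A \subset Ph by rewrite setIS // morphpreS // sub1G.
have imPh : f1 @* Ph = P.
  apply/setP=> g; apply/morphimP/idP=> [[z _ /setIP[_ /morphpreP[_ Pz]] -> //] | Pg].
  have Dg : (g, coset R g) \in D by apply: imset_f.
  exists (g, coset R g) => //.
  by apply/setIP; split; [apply: (subsetP sDE) | apply/morphpreP; rewrite inE].
have coA : coprime #|A| #|E : Ph|.
  have: (#|f1 @* E : f1 @* Ph| * #|'ker_E f1 : Ph|)%N = #|E : Ph|.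
    by apply: index_morphim_ker; rewrite ?subsetT ?subsetIl.
  rewrite imE imPh (_ : #|'ker_E f1 : Ph| = 1%N); last by apply/eqP; rewrite indexg_eq1.
  rewrite muln1 => <-; by apply: pnat_coprime pA _; case/and3P: sylP.
have splP : [splits Ph, over A].
  apply/splitsP; exists D; apply/complP; split.
    apply/trivgP/subsetP=> _ /setIP[/AP[q _ ->]] /imsetP[x _ [<- ->]].
    by rewrite morph1 inE.
  apply/eqP; rewrite eqEsubset mul_subG //=; last first.
    rewrite subsetI sDE; apply/subsetP=> _ /imsetP[x Px ->]; by rewrite !inE.
  apply/subsetP=> z Phz; have [Ez /morphpreP[_ /= Pz]] := setIP Phz.
  have Dz : (z.1, coset R z.1) \in D by apply: imset_f.
  rewrite -(mulgKV (z.1, coset R z.1) z) mem_mulg // inE groupM ?groupV ?(subsetP sDE _ Dz) //=.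
  by apply/kerP; rewrite ?inE //= mulgV.
have := splP; rewrite -(Gaschutz_split nsAE sAPh (subsetIl _ _) abA coA).
case/splitsP=> L /complP[tiAL defE].
have sLE : L \subset E by rewrite -defE mulG_subr.
have sub2 : f2 @* L \subset P / R.
  apply/subsetP=> _ /morphimP[z _ /(subsetP sLE)/EP[_ [x Px [zx _]]] ->] /=.
  by rewrite zx mem_quotient.
have im2 : f2 @* L = P / R.
  rewrite -[LHS]genGid; apply: (@Phi_nongen _ (P / R)%G).
  apply/eqP; rewrite eqEsubset join_subG Phi_sub sub2 /=.
  apply/subsetP=> _ /morphimP[x _ Px ->].
  have: (x, coset R x) \in A * L by rewrite defE (subsetP sDE) ?imset_f.
  case/mulsgP=> a l /AP[q Qq ->] Ll /(congr1 snd); rewrite snd_morphM /= => ->.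
  rewrite -(quotient_Phi pP nRP) groupM //.
    by rewrite (subsetP (joing_subl _ _)) // mem_quotient // (subsetP sQPhi).
  by rewrite (subsetP (joing_subr _ _)) //; apply: (mem_morphim f2); rewrite ?inE.
(* [f1] identifies [L] with [G], and [X] is the kernel of the resulting map from [G] onto
   [P / R]. *)
pose X := (f1 @* 'ker_L f2)%G.
have imL : f1 @* L = G.
  apply/eqP; rewrite eqEsubset -{1}imE morphimS //=; apply/subsetP=> g.
  rewrite -imE => /morphimP[z _ Ez ->]; move: Ez; rewrite -defE.
  case/mulsgP=> a l /AP[q _ ->] Ll ->; rewrite /= mul1g.
  by apply: (mem_morphim f1); rewrite ?inE.
have nsXG : X <| G.
  by rewrite -imL; apply: morphim_normal; apply: normalGI (subsetT _) (ker_normal f2).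
have iGX : #|G : X| = #|P : R|.
  have: (#|f1 @* L : f1 @* 'ker_L f2| * #|'ker_L f1 : 'ker_L f2|)%N = #|L : 'ker_L f2|.
    by apply: index_morphim_ker; rewrite ?subsetT ?subsetIl.
  rewrite imL (_ : 'ker_L f1 = 1) /=; last first.
    by apply/trivgP; rewrite -tiAL subsetI subsetIl andbT setSI.
  rewrite (_ : #|1 : 'ker_L f2| = 1%N); last by apply/eqP; rewrite indexg_eq1 sub1G.
  by rewrite muln1 => ->; rewrite indexgI -(card_quotient nRP) -im2 card_morphim setTI.
have sXN : X \subset N.
  apply/subsetP=> _ /morphimP[z _ /setIP[Lz /mker /= z2] ->].
  have /EP[_ [x Px [zx Nzx]]] := subsetP sLE z Lz.
  have Rx : x \in R by apply: coset_idr; rewrite ?(subsetP nRP) // -zx.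
  by rewrite -(groupMr _ (groupVr (subsetP (subset_trans sRQ (subsetIr P N)) x Rx))).
have eqXN : X :=: N.
  apply: (minN X _ sXN); rewrite nsXG (subset_trans sXN) // andbT.
  rewrite pgroupE card_quotient ?normal_norm // iGX.
  by apply: pnat_dvd pP; apply: dvdn_indexg.
rewrite -iGX eqXN -defG indexMg -(indexgI P N) //.
Qed.

(** * Counting generating tuples *)

(** Keeping [H] as a parameter allows recursion on the first entry. For [H = 'Phi(G)] this is
    [gen_count]; for normal [H] it counts the tuples that generate [G / H]. *)
Definition gen_over_count (gT : finGroupType) (G H : {group gT}) (k : nat) : nat :=
  #|[set t : {ffun 'I_k -> gT} |
      [forall i, t i \in G] && (H <*> [set t i | i : 'I_k] == G)]|.

Lemma gen_over_count0 (gT : finGroupType) (G H : {group gT}) :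
  gen_over_count G H 0 = (H :==: G).
Proof.
have eqX (t : {ffun 'I_0 -> gT}) : [set t i | i : 'I_0] = set0.
  by apply/setP=> x; rewrite inE; apply/imsetP=> [[[]]].
rewrite /gen_over_count; have [eqHG | neqHG] := eqVneq (H : {set gT}) G.
  rewrite (_ : [set t | _] = setT) ?cardsT ?card_ffun ?card_ord //.
  apply/setP=> t; rewrite !inE eqX; apply/andP; split; first by apply/forallP=> [[]].
  by rewrite joingE setU0 genGid eqHG.
apply/eqP; rewrite cards_eq0; apply/eqP/setP=> t; rewrite !inE eqX joingE setU0 genGid.
by rewrite (negPf neqHG) andbF.
Qed.

Lemma gen_over_countS (gT : finGroupType) (G H : {group gT}) k :
  gen_over_count G H k.+1 = \sum_(g in G) gen_over_count G (H <*> <[g]>)%G k.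
Proof.
pose f g (t : {ffun 'I_k -> gT}) : {ffun 'I_k.+1 -> gT} :=
  [ffun i => if unlift ord0 i is Some j then t j else g].
have f0 g t : f g t ord0 = g by rewrite ffunE unlift_none.
have fS g t j : f g t (lift ord0 j) = t j by rewrite ffunE liftK.
have f_inj g : injective (f g).
  by move=> t u eq_tu; apply/ffunP=> j; rewrite -(fS g) eq_tu fS.
have genf g t : H <*> [set f g t i | i : 'I_k.+1] = H <*> <[g]> <*> [set t i | i : 'I_k].
  rewrite /cycle joing_idr (joingE H) joing_idl !joingE -setUA; congr <<_ :|: _>>.
  apply/setP=> x; rewrite !inE; apply/imsetP/idP=> [[i _ ->] | ].
    by case: (unliftP ord0 i) => [j ->|->]; rewrite ?f0 ?eqxx // fS imset_f ?orbT.
  by case/predU1P=> [-> | /imsetP[j _ ->]]; [exists ord0 | exists (lift ord0 j)]; rewrite ?f0 ?fS.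
have allf g t : g \in G -> [forall i, f g t i \in G] = [forall i, t i \in G].
  move=> Gg; apply/forallP/forallP=> Gt i; first by rewrite -(fS g).
  by case: (unliftP ord0 i) => [j ->|->]; rewrite ?f0 ?fS.
have eta (t : {ffun 'I_k.+1 -> gT}) : t = f (t ord0) [ffun j => t (lift ord0 j)].
  by apply/ffunP=> i; case: (unliftP ord0 i) => [j ->|->]; rewrite ?f0 ?fS ?ffunE.
rewrite /gen_over_count -sum1_card.
rewrite (partition_big (fun t : {ffun 'I_k.+1 -> gT} => t ord0) (mem G)) /=; last first.
  by move=> t; rewrite inE => /andP[/forallP].
apply: eq_bigr => g Gg; rewrite sum1dep_card -(card_imset _ (f_inj g)).
apply: eq_card => t; rewrite !inE; apply/idP/imsetP => [|[u]].
  case/andP=> /andP[Gt gen_t] /eqP t0; exists [ffun j => t (lift ord0 j)]; last by rewrite -t0 -eta.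
  by rewrite inE -(allf g) // -genf -t0 -eta Gt.
by rewrite inE -(allf g) // -genf => /andP[Gu gen_u] ->; rewrite Gu gen_u f0 eqxx.
Qed.

Local Open Scope R_scope.

(* The probability that k random vectors span F_2^e. *)
Fixpoint span_prob (e k : nat) : R :=
  if e is e'.+1 then span_prob e' k * (1 - 2 ^ e' / 2 ^ k) else 1.

Lemma INR_expn a k : INR (a ^ k)%N = INR a ^ k.
Proof. by elim: k => //= k IHk; rewrite expnS -multE mult_INR IHk. Qed.

Lemma pow2_neq0 k : 2 ^ k <> 0.
Proof. apply: pow_nonzero; lra. Qed.

Lemma span_prob_shift e k : span_prob e.+1 k.+1 = span_prob e k * (1 - / 2 ^ k.+1).
Proof.
elim: e => [|e IHe]; first by rewrite /=; field; exact: pow2_neq0.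
rewrite [LHS]/= -/(span_prob e.+1 k.+1) IHe /=; field; exact: pow2_neq0.
Qed.

(** The first vector is zero with probability [/ 2 ^ e.+1]; otherwise the remaining ones have to
    span a quotient of dimension [e]. *)
Lemma span_prob_rec e k :
  span_prob e.+1 k.+1 = / 2 ^ e.+1 * span_prob e.+1 k + (1 - / 2 ^ e.+1) * span_prob e k.
Proof.
rewrite span_prob_shift /=; field; split; exact: pow2_neq0.
Qed.

Lemma gen_over_count_span_prob (gT : finGroupType) (G H : {group gT}) e k :
    elem2_over G H -> #|G : H| = (2 ^ e)%N ->
  INR (gen_over_count G H k) = INR #|G| ^ k * span_prob e k.
Proof.
elim: k H e => [|k IHk] H e eH iH.
  rewrite gen_over_count0 /= Rmult_1_l; case: e iH => [|e] iH.
    by have [sHG _ _] := eH; rewrite (index1g sHG iH) eqxx.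
  have -> : (H :==: G) = false.
    by apply/eqP=> eqHG; move/(congr1 odd): iH; rewrite eqHG indexgg oddX.
  (* Without vectors, the innermost factor [1 - 2 ^ 0 / 2 ^ 0] is zero. *)
  elim: (e) => [|n IHn]; first by rewrite /=; field.
  by rewrite [RHS]/= -/(span_prob n.+1 0) -IHn Rmult_0_l.
have [sHG _ _] := eH.
rewrite gen_over_countS (bigID (mem H)) /=.
have -> : (\sum_(g in G | g \in H) gen_over_count G (H <*> <[g]>) k =
    #|H| * gen_over_count G H k)%N.
  rewrite -sum_nat_const; apply: eq_big => [g | g /andP[_ Hg]].
    by rewrite andb_idl //; apply: subsetP.
  by congr gen_over_count; apply: val_inj; rewrite /= (joing_idPl _) ?cycle_subG.
have oG := Lagrange sHG; rewrite iH in oG.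
have oGR : INR #|G| = INR #|H| * 2 ^ e.
  by rewrite -oG -multE mult_INR INR_expn.
have cH := IHk H e eH iH.
case: e iH oG oGR cH => [|e] iH oG oGR cH.
  rewrite big_pred0 => [|g]; last first.
    by rewrite (index1g sHG iH) andbN.
  rewrite addn0 -multE mult_INR cH oGR /=; ring.
have [g0 Gg0 nHg0] : exists2 g, g \in G & g \notin H.
  apply/subsetPn; rewrite -indexg_eq1 iH; apply/eqP=> /(congr1 odd).
  by rewrite oddX.
have IHg g : g \in G -> g \notin H ->
    INR (gen_over_count G (H <*> <[g]>) k) = INR #|G| ^ k * span_prob e k.
  move=> Gg nHg; have sHgG : H <*> <[g]> \subset G by rewrite join_subG sHG cycle_subG.
  apply: IHk; first exact: (@elem2_overS _ G H _ eH (joing_subl _ _) sHgG).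
  have oHg := elem2_over_card_joing_cycle eH Gg nHg.
  apply/eqP; rewrite -(eqn_pmul2l (cardG_gt0 (H <*> <[g]>))) Lagrange // oHg -oG expnS.
  by rewrite [(2 * #|H|)%N]mulnC -mulnA.
have -> : (\sum_(g in G | g \notin H) gen_over_count G (H <*> <[g]>) k =
    #|G :\: H| * gen_over_count G (H <*> <[g0]>) k)%N.
  rewrite -sum_nat_const; apply: eq_big => [g | g /andP[Gg nHg]]; first by rewrite inE andbC.
  by apply: INR_eq; rewrite !IHg.
have oD : INR #|G :\: H| = INR #|G| - INR #|H|.
  rewrite -(cardsID H G) (setIidPr sHG) -plusE plus_INR; ring.
rewrite -plusE -!multE plus_INR !mult_INR cH IHg // oD span_prob_rec.
have -> : INR #|H| = INR #|G| * / 2 ^ e.+1 by rewrite oGR; field; exact: pow2_neq0.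
move: (INR #|G|) (/ 2 ^ e.+1) (span_prob e.+1 k) (span_prob e k) => b c d f; ring.
Qed.

Lemma gen_count_Phi (gT : finGroupType) (G : {group gT}) k :
  gen_count G k = gen_over_count G 'Phi(G) k.
Proof.
apply: eq_card => t; rewrite !inE; case Gt: [forall i, _] => //=.
have sXG : [set t i | i : 'I_k] \subset G.
  by apply/subsetP=> _ /imsetP[i _ ->]; apply: (forallP Gt).
apply/eqP/eqP=> [defG | /Phi_nongen //].
apply/eqP; rewrite eqEsubset join_subG Phi_sub sXG -{1}defG; exact: genS (subsetUr _ _).
Qed.

Lemma gen_count_2group (gT : finGroupType) (P : {group gT}) d k :
    2.-group P -> #|P : 'Phi(P)| = (2 ^ d)%N ->
  INR (gen_count P k) = INR #|P| ^ k * span_prob d k.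
Proof.
move=> pP iP; rewrite gen_count_Phi.
by apply: gen_over_count_span_prob => //; apply: elem2_over_Phi.
Qed.

Close Scope R_scope.

(** [K / N] is the Frattini subgroup of [G / N], so a tuple generating [G] modulo [K] generates some
    [M] with [N * M = G]. As [N] has prime order, either [M = G], or [M] is a complement of [N],
    that is, one of at most three Sylow 2-subgroups. *)
Lemma gen_over_count_leq_Syl (gT : finGroupType) (G N K P : {group gT}) d k :
    N <| G -> #|N| = 3%N -> 2.-Sylow(G) P -> N * P = G -> elem2_over G K ->
    P :&: K = 'Phi(P) -> #|P : 'Phi(P)| = (2 ^ d)%N ->
  (gen_over_count G K k <= gen_count G k + 3 * gen_count P k)%N.
Proof.
move=> nsNG oN sylP defG eK tiPK iP.
have [sNG nNG] := andP nsNG; have [sPG pP _] := and3P sylP; have [sKG _ _] := eK.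
have nKG := normal_norm (elem2_over_normal eK); have nNP := subset_trans sPG nNG.
have sNK : N \subset K.
  rewrite -quotient_sub1 ?(subset_trans sNG) //.
  have p2 := pgroupS (quotientS K sNG) (elem2_over_pgroup eK).
  have p3 : 2^'.-group (N / K) by rewrite quotient_pgroup // pgroupE oN.
  by rewrite -(setIid (N / K)) coprime_TIg ?(pnat_coprime p2 p3).
have tiNP : N :&: P = 1 by apply: coprime_TIg; rewrite oN coprime_sym; apply: pnat_coprime pP _.
have oG : #|G| = (3 * #|P|)%N by rewrite -defG TI_cardMg ?oN.
have defK : N * 'Phi(P) = K by rewrite -tiPK group_modl // defG; apply/setIidPr.
have pGN : 2.-group (G / N) by rewrite -defG quotientMidl quotient_pgroup.
have defKN : K / N = 'Phi(G / N).
  by rewrite -defK quotientMidl (quotient_Phi pP nNP) -defG quotientMidl.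
have le3 : (#|'Syl_2(G)| <= 3)%N.
  rewrite (card_Syl sylP); apply: leq_trans (_ : #|G : P| <= _)%N.
    by rewrite dvdn_leq ?indexg_gt0 // indexgS // subsetI sPG normG.
  by rewrite -divgS // oG mulnK.
pose gens (H : {group gT}) := [set t : {ffun 'I_k -> gT} |
      [forall i, t i \in H] && (<<[set t i | i : 'I_k]>> == H)].
have leA : (gen_over_count G K k <= #|gens G :|: \bigcup_(H in 'Syl_2(G)) gens H|)%N.
  apply: subset_leq_card; apply/subsetP=> t; rewrite inE => /andP[Gt /eqP genK].
  pose M := <<[set t i | i : 'I_k]>>%G.
  have tM i : t i \in M by rewrite mem_gen // imset_f.
  have sMG : M \subset G by rewrite gen_subG -genK sub_gen // subsetUr.
  have nNM := subset_trans sMG nNG.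
  have defNM : N * M = G.
    apply/eqP; rewrite eqEsubset mul_subG //= -quotientSK //.
    have <- // : M / N = G / N.
    rewrite -[LHS]genGid; apply: (@Phi_nongen _ (G / N)%G); rewrite /= -defKN.
    rewrite -quotientY ?(subset_trans sKG) //; congr (_ / N); rewrite -genK.
    by rewrite /= joing_idr.
  have [sNM | nsNM] := boolP (N \subset M).
    have eqMG : M :=: G by rewrite -defNM mulSGid.
    by rewrite inE inE Gt -/(gval M) eqMG eqxx.
  have tiNM : N :&: M = 1 by apply: prime_TIg; rewrite ?oN.
  have oM : #|M| = #|P|.
    by apply/eqP; rewrite -(eqn_pmul2l (_ : 0 < 3)%N) // -oG -oN -TI_cardMg // defNM.
  rewrite inE; apply/orP; right; apply/bigcupP; exists M.
    by rewrite inE pHallE sMG /= -[#|<<_>>|]/#|M| oM (card_Hall sylP).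
  by rewrite inE eqxx andbT; apply/forallP.
apply: leq_trans leA _; apply: leq_trans (leq_card_setU _ _) _; rewrite leq_add2l.
have leU : #|\bigcup_(H in 'Syl_2(G)) gens H| <= \sum_(H in 'Syl_2(G)) #|gens H|.
  elim/big_rec2: _ => [|H m A _ leA]; first by rewrite cards0.
  by apply: leq_trans (leq_card_setU _ _) _; rewrite leq_add2l.
apply: leq_trans leU _; apply: leq_trans (leq_mul le3 (leqnn _)).
rewrite -sum_nat_const; apply: leq_sum => H; rewrite inE => sylH.
have [x Gx defH] := Sylow_trans sylP sylH.
rewrite -/(gen_count H k) leq_eqVlt; apply/orP; left; apply/eqP/INR_eq.
rewrite (gen_count_2group k pP iP) (@gen_count_2group _ H d) ?(pHall_pgroup sylH) //.
  by rewrite defH cardJg.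
by rewrite defH PhiJ indexJg.
Qed.

(** * The infinite products *)

Local Open Scope R_scope.

Lemma nonneg_infinite_sum (f : nat -> R) M :
    (forall n, 0 <= f n) -> (forall n, sum_f_R0 f n <= M) ->
  exists l, [/\ infinite_sum f l, l <= M & forall n, sum_f_R0 f n <= l].
Proof.
move=> f0 fM.
have grow : Un_growing (sum_f_R0 f) by move=> n /=; have := f0 n.+1; lra.
have [l cvl] : {l | Un_cv (sum_f_R0 f) l}.
  by apply: growing_cv grow _; exists M => _ [n ->].
exists l; split=> //; last exact: growing_ineq grow cvl.
apply: (Rle_cv_lim fM cvl); move=> eps eps0; exists 0%N => n _.
by rewrite /R_dist Rminus_diag Rabs_R0.
Qed.

Lemma inv_pow2_half k : / 2 ^ k.+1 = / 2 ^ k / 2.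
Proof. by rewrite /=; field; apply: pow_nonzero; lra. Qed.

Lemma inv_pow2_gt0 k : 0 < / 2 ^ k.
Proof. by apply: Rinv_0_lt_compat; apply: pow_lt; lra. Qed.

Lemma inv_pow2_le1 k : / 2 ^ k <= 1.
Proof.
elim: k => [|k IHk]; first by rewrite /=; lra.
by rewrite inv_pow2_half; have := inv_pow2_gt0 k; lra.
Qed.

Lemma nu_partial_prodS j m :
  nu_partial_prod j m.+1 = nu_partial_prod j m * (1 - / 2 ^ (j + m).+1).
Proof. by rewrite [LHS]/= addnS. Qed.

Lemma nu_partial_prod_bounds j m : 0 <= nu_partial_prod j m <= 1.
Proof.
elim: m => [|m IHm]; first by rewrite /=; lra.
have := inv_pow2_gt0 (j + m).+1; have := inv_pow2_le1 (j + m).+1.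
rewrite nu_partial_prodS; move: (nu_partial_prod _ _) (/ _) IHm => a b; nra.
Qed.

Lemma nu_partial_prod_decreasing j : Un_decreasing (nu_partial_prod j).
Proof.
move=> m; have := nu_partial_prod_bounds j m; have := inv_pow2_gt0 (j + m).+1.
by rewrite nu_partial_prodS; move: (nu_partial_prod _ _) (/ _) => a b; nra.
Qed.

(** A product of factors 1 - x is at least 1 minus the sum of the x; here the sum is geometric. In
    the limit this makes [1 - nu_prod j] summable. *)
Lemma nu_partial_prod_lower j m : 1 - / 2 ^ j + / 2 ^ (j + m) <= nu_partial_prod j m.
Proof.
elim: m => [|m IHm]; first by rewrite addn0 /=; lra.
have := nu_partial_prod_bounds j m; have := inv_pow2_gt0 (j + m).
rewrite nu_partial_prodS addnS inv_pow2_half.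
move: (nu_partial_prod _ _) (/ 2 ^ (j + m)) (/ 2 ^ j) IHm => a b c; nra.
Qed.

Lemma nu_partial_prod_cv j : {l | Un_cv (nu_partial_prod j) l}.
Proof.
apply: decreasing_cv (@nu_partial_prod_decreasing j) _; exists 0 => _ [m ->].
by rewrite /opp_seq; have := nu_partial_prod_bounds j m; lra.
Qed.

Definition nu_prod j : R := proj1_sig (nu_partial_prod_cv j).

Lemma nu_prodP j : Un_cv (nu_partial_prod j) (nu_prod j).
Proof. exact: proj2_sig (nu_partial_prod_cv j). Qed.

Lemma nu_prod_le j m : nu_prod j <= nu_partial_prod j m.
Proof. exact: decreasing_ineq (@nu_partial_prod_decreasing j) (@nu_prodP j) m. Qed.

Lemma nu_prod_ge j : 1 - / 2 ^ j <= nu_prod j.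
Proof.
have lbn n : 1 - / 2 ^ j <= nu_partial_prod j n.
  by have := nu_partial_prod_lower j n; have := inv_pow2_gt0 (j + n); lra.
apply: (Rle_cv_lim lbn _ (@nu_prodP j)); move=> eps eps0; exists 0%N => n _.
by rewrite /R_dist Rminus_diag Rabs_R0.
Qed.

Lemma nu_sum_exists :
  exists2 nu, infinite_sum (fun j => 1 - nu_prod j) nu &
    forall n, sum_f_R0 (fun j => 1 - nu_prod j) n <= nu.
Proof.
suff [nu [? _ ?]] : exists nu, [/\ infinite_sum (fun j => 1 - nu_prod j) nu, nu <= 2 &
    forall n, sum_f_R0 (fun j => 1 - nu_prod j) n <= nu] by exists nu.
apply: nonneg_infinite_sum => n.
  by have := nu_prod_le n 0; rewrite /=; lra.
suff : sum_f_R0 (fun j => 1 - nu_prod j) n <= 2 - / 2 ^ n by have := inv_pow2_gt0 n; lra.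
elim: n => [|n IHn]; first by have := nu_prod_ge 0; rewrite /=; lra.
have := nu_prod_ge n.+1; rewrite [sum_f_R0 _ _]/= inv_pow2_half.
by have := inv_pow2_gt0 n; lra.
Qed.

Lemma nu_partial_prod_add4 j d :
  nu_partial_prod j (d + 4) = nu_partial_prod j d * ((1 - / 2 ^ (j + d).+1) *
    (1 - / 2 ^ (j + d).+2) * (1 - / 2 ^ (j + d).+3) * (1 - / 2 ^ (j + d).+4)).
Proof. by rewrite addn4 !nu_partial_prodS !addnS; ring. Qed.

(** At [m = 5] this is 1/81 <= 1/64; at [m = 4] it fails, 1/27 being larger than 1/32. *)
Lemma cubic_le_half m : (4 < m)%N -> 3 / 3 ^ m <= / 2 ^ m.+1.
Proof.
elim: m => // m IHm; rewrite ltnS leq_eqVlt => /orP[/eqP<- | /IHm{}IHm]; first by rewrite /=; lra.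
have -> : 3 / 3 ^ m.+1 = 3 / 3 ^ m / 3.
  by rewrite [3 ^ m.+1]/=; field; apply: pow_nonzero; lra.
by rewrite inv_pow2_half; have := inv_pow2_gt0 m.+1; lra.
Qed.

(* The factor coming from the chief factor of order 3 is absorbed by the next four
   factors of the infinite product. *)
Lemma nu_prod_le_cubic j d : (2 < j + d)%N ->
  nu_prod j <= nu_partial_prod j d * (1 - 3 / 3 ^ (j + d)).
Proof.
move=> lt2; apply: Rle_trans (nu_prod_le j (d + 4)) _; rewrite nu_partial_prod_add4.
apply: Rmult_le_compat_l; first by case: (nu_partial_prod_bounds j d).
move: (j + d)%N lt2 => m {j d}.
(* At [m = 3] all four factors are needed, three of them leaving about 0.894, above 8/9; from
   [m = 5] on the first factor is enough. *)
rewrite leq_eqVlt => /orP[/eqP<- | ]; first by rewrite /=; lra.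
rewrite leq_eqVlt => /orP[/eqP<- | /cubic_le_half]; first by rewrite /=; lra.
have := inv_pow2_gt0 m.+1; have := inv_pow2_le1 m.+1.
rewrite (inv_pow2_half m.+3) (inv_pow2_half m.+2) (inv_pow2_half m.+1).
move: (/ 2 ^ m.+1) (3 / 3 ^ m) => a b a1 a0 ba.
have: (1 - a) * (1 - a / 2) <= 1 - a by nra.
have: 0 <= (1 - a) * (1 - a / 2) by nra.
move: ((1 - a) * (1 - a / 2)) => c c0 ca.
have: c * (1 - a / 2 / 2) <= c by nra.
have: 0 <= c * (1 - a / 2 / 2) by nra.
move: (c * (1 - a / 2 / 2)) => u u0 uc; nra.
Qed.

(** At [j = 0] the termwise comparison fails: the right side is 1/4, while [nu_prod 0] is about
    0.289. The terms from 1 to 4 make up for the deficit. *)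
Lemma nu_prod_sum_cubic2 :
  sum_f_R0 nu_prod 4 <=
  sum_f_R0 (fun j => nu_partial_prod j 2 * (1 - 3 / 3 ^ (j + 2))) 4.
Proof.
have := nu_prod_le 0 9; have := nu_prod_le 1 8; have := nu_prod_le 2 7.
have := nu_prod_le 3 6; have := nu_prod_le 4 5.
rewrite /=; lra.
Qed.

Lemma sum_cubic_le d m : (1 < d)%N -> (3 < m)%N ->
  sum_f_R0 nu_prod m <= sum_f_R0 (fun j => nu_partial_prod j d * (1 - 3 / 3 ^ (j + d))) m.
Proof.
rewrite leq_eqVlt => /orP[/eqP<- | lt2d _].
  elim: m => // m IHm; rewrite leq_eqVlt => /orP[/eqP<- | /IHm{}IHm].
    exact: nu_prod_sum_cubic2.
  rewrite /= -/(nu_partial_prod m.+1 2); apply: Rplus_le_compat => //.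
  by apply: nu_prod_le_cubic; lia.
by apply: sum_Rle => j _; apply: nu_prod_le_cubic; apply: leq_trans lt2d (leq_addl _ _).
Qed.

Lemma sum_shift_le (a : nat -> R) d m : (forall k, a k <= 1) ->
  sum_f_R0 a (d + m) <= INR d + sum_f_R0 (fun j => a (j + d)%N) m.
Proof.
move=> a1; elim: m => [|m IHm]; last by rewrite addnS /= addSn (addnC m d); lra.
rewrite addn0 /= add0n; elim: d => [|d IHd]; first by rewrite /=; lra.
by rewrite S_INR /=; have := a1 d; lra.
Qed.

Lemma sum_f_R0_mono (a : nat -> R) n m : (forall k, 0 <= a k) -> (n <= m)%N ->
  sum_f_R0 a n <= sum_f_R0 a m.
Proof.
move=> a0; elim: m => [|m IHm]; first by rewrite leqn0 => /eqP->; apply: Rle_refl.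
rewrite leq_eqVlt => /orP[/eqP-> | /IHm]; first exact: Rle_refl.
by rewrite /=; have := a0 m.+1; lra.
Qed.

(** Each of the first [d] terms costs at most 1, which gives the summand [INR d]; the later ones are
    compared with nu through partial sums only, since termwise comparison can fail. *)
Lemma infinite_sum_comparison (p : nat -> R) d nu :
    (forall k, 0 <= p k <= 1) ->
    (forall m, (3 < m)%N -> sum_f_R0 nu_prod m <= sum_f_R0 (fun j => p (j + d)%N) m) ->
    (forall n, sum_f_R0 (fun j => 1 - nu_prod j) n <= nu) ->
  exists2 e, infinite_sum (fun k => 1 - p k) e & e <= INR d + nu.
Proof.
move=> p01 le_p le_nu.
have [||e [sum_e le_e _]] := @nonneg_infinite_sum (fun k => 1 - p k) (INR d + nu).
- by move=> n; have := p01 n; lra.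
(* Lengthening the partial sum leaves a tail long enough for the comparison. *)
- move=> n; apply: Rle_trans (_ : sum_f_R0 (fun k => 1 - p k) (d + n.+4) <= _).
    apply: sum_f_R0_mono => [k|]; [by have := p01 k; lra | lia].
  apply: Rle_trans (sum_shift_le _ _ _) _ => [k|]; first by have := p01 k; lra.
  apply: Rplus_le_compat_l; apply: Rle_trans (le_nu n.+4); rewrite !minus_sum.
  by have := le_p n.+4 isT; lra.
by exists e.
Qed.

(** * The bound *)

(** This is where nu comes from: with [j] surplus vectors the spanning probability is a truncation
    of its infinite product, and truncating only increases the value. *)
Lemma span_prob_nu j d : span_prob d (j + d) = nu_partial_prod j d.
Proof.
elim: d => [|d IHd] //; rewrite nu_partial_prodS -IHd.
by rewrite addnS span_prob_shift.
Qed.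

Lemma gen_count_le (gT : finGroupType) (G : {group gT}) k : (gen_count G k <= #|G| ^ k)%N.
Proof.
rewrite -[k in (_ ^ k)%N]card_ord -card_ffun_on; apply: subset_leq_card.
by apply/subsetP=> t; rewrite inE => /andP[/forallP Gt _]; apply/ffun_onP.
Qed.

Lemma INR_cardG_pow_gt0 (gT : finGroupType) (G : {group gT}) k : 0 < INR (#|G| ^ k)%N.
Proof. by apply: lt_0_INR; apply/ltP; rewrite expn_gt0 cardG_gt0. Qed.

Lemma probgen_bounds (gT : finGroupType) (G : {group gT}) k : 0 <= probgen G k <= 1.
Proof.
have G0 := INR_cardG_pow_gt0 G k; split.
  by apply: Rle_mult_inv_pos => //; apply: pos_INR.
apply: (Rmult_le_reg_r (INR (#|G| ^ k)%N)) => //.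
rewrite /probgen /Rdiv Rmult_assoc Rinv_l ?Rmult_1_r ?Rmult_1_l; last lra.
by apply: le_INR; apply/leP; apply: gen_count_le.
Qed.

Lemma probgen_2group (gT : finGroupType) (P : {group gT}) d k :
  2.-group P -> #|P : 'Phi(P)| = (2 ^ d)%N -> probgen P k = span_prob d k.
Proof.
move=> pP iP; have P0 := INR_cardG_pow_gt0 P k.
rewrite /probgen (gen_count_2group k pP iP) -INR_expn; field; lra.
Qed.

(** A random tuple lies in a given Sylow 2-subgroup with probability [/ 3 ^ k] and then generates it
    with probability [span_prob d k]; at most three such subgroups account for the loss. *)
Lemma probgen_complement3 (gT : finGroupType) (G N K P : {group gT}) d k :
    N <| G -> #|N| = 3%N -> 2.-Sylow(G) P -> (N * P)%g = G -> elem2_over G K ->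
    #|G : K| = (2 ^ d)%N -> P :&: K = 'Phi(P) -> #|P : 'Phi(P)| = (2 ^ d)%N ->
  span_prob d k * (1 - 3 / 3 ^ k) <= probgen G k.
Proof.
move=> nsNG oN sylP defG eK iK tiPK iP; have [_ pP _] := and3P sylP.
have P0 := INR_cardG_pow_gt0 P k; have G0 := INR_cardG_pow_gt0 G k.
have tiNP : N :&: P = 1%g.
  by apply: coprime_TIg; rewrite oN coprime_sym; apply: pnat_coprime pP _.
have oG : (#|G| ^ k)%N = (3 ^ k * #|P| ^ k)%N by rewrite -expnMn -defG TI_cardMg ?oN.
have oGR : INR (#|G| ^ k)%N = 3 ^ k * INR (#|P| ^ k)%N.
  by rewrite oG -multE mult_INR INR_expn; congr (_ ^ _ * _); rewrite /=; ring.
have := gen_over_count_leq_Syl k nsNG oN sylP defG eK tiPK iP.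
move/leP/le_INR; rewrite -plusE -multE plus_INR mult_INR.
rewrite (gen_over_count_span_prob k eK iK) (gen_count_2group k pP iP) -!INR_expn => leG.
apply: (Rmult_le_reg_r (INR (#|G| ^ k)%N)) => //.
rewrite /probgen /Rdiv [X in _ <= X]Rmult_assoc Rinv_l ?Rmult_1_r; last lra.
move: leG; rewrite oGR (_ : INR 3 = 3); last by rewrite /=; ring.
have := pow_lt 3 k; move: (3 ^ k) (INR _) (span_prob d k) (INR (gen_count G k)) => a b c g.
move=> /(_ ltac:(lra)) a0 leG.
have -> : c * (1 - 3 * / a) * (a * b) = a * b * c - 3 * (b * c) by field; lra.
lra.
Qed.

Close Scope R_scope.
Close Scope group_scope.

Theorem theorem11 (n : nat) (G : {group {perm 'I_n}})
    (s : seq {group {perm 'I_n}}) :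
  n <> 3%N ->
  chief_series G s ->
  alpha21_of G s = n./2 ->
  exists (e nu : R) (P : nat -> R),
    (forall j : nat, Un_cv (fun m => nu_partial_prod j m) (P j)) /\
    infinite_sum (fun j => Rminus Rdefinitions.R1 (P j)) nu /\
    infinite_sum (fun k => Rminus Rdefinitions.R1 (probgen G k)) e /\
    Rle e (Rplus (INR n./2) nu).
Proof.
move=> n_neq3 chief_s alpha_s.
have [K eK iK] := alpha21_elem2_over chief_s; rewrite alpha_s in iK.
have [P sylP] := Sylow_exists 2 G; have [sPG pP _] := and3P sylP.
have defGK := Sylow_mul_normal sylP (elem2_over_normal eK) (elem2_over_pgroup eK).
have iPK : #|P : P :&: K|%g = (2 ^ n./2)%N by rewrite indexgI -indexMg defGK.
have sPhi : 'Phi(P)%g \subset P :&: K.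
  by rewrite subsetI Phi_sub (Phi_sub_elem2_over eK pP sPG).
have leP : #|P : 'Phi(P)|%g <= 2 ^ n./2.
  have actT : [acts P, on setT | 'P]%g by apply/actsP=> g _ x; rewrite !inE.
  have C1 : 'C_P([set: 'I_n] | 'P)%g = 1%g.
    apply/trivgP/subsetP=> g /setIP[_ /astabP fixg]; apply/set1P/permP=> x; rewrite perm1.
    by have := fixg x; rewrite inE => /(_ isT).
  by have := index_Phi_astab pP actT; rewrite C1 joingG1 cardsT card_ord.
have iPhi := Lagrange_index (subsetIl P K) sPhi; rewrite iPK in iPhi.
have tiPK : (P :&: K)%g = 'Phi(P)%g.
  apply/esym/index1g => //; apply/eqP; rewrite eqn_leq indexg_gt0 andbT.
  by rewrite -(leq_pmul2l (_ : 0 < 2 ^ n./2)) ?expn_gt0 // iPhi muln1.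
have iP : #|P : 'Phi(P)|%g = (2 ^ n./2)%N by rewrite -tiPK.
have [N [nsNG p'N defG]] : exists N : {group {perm 'I_n}},
    [/\ N <| G, 2^'.-group N & N * P = G]%g.
  by apply: Tate_Phi_complement sylP (elem2_over_normal eK) (elem2_over_pgroup eK) _; rewrite tiPK.
have [nu sum_nu le_nu] := nu_sum_exists.
suff [e sum_e le_e] : exists2 e, infinite_sum (fun k => Rminus Rdefinitions.R1 (probgen G k)) e &
    Rle e (Rplus (INR n./2) nu).
  by exists e, nu, nu_prod; split; first exact: nu_prodP.
apply: infinite_sum_comparison le_nu => [k | m m_gt3]; first exact: probgen_bounds.
have oddN : odd #|N| by move: p'N; rewrite /pgroup p'natE // dvdn2 negbK.
have iP' : #|P : 'Phi(P)|%g = (2 ^ #|'I_n|./2)%N by rewrite card_ord.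
have [N1 | ntN] := eqVneq (N : {set {perm 'I_n}}) 1%g.
  have eqPG : P = G by apply: val_inj; rewrite /= -defG N1 mul1g.
  apply: sum_Rle => j _; rewrite -eqPG (probgen_2group _ pP iP) span_prob_nu.
  exact: nu_prod_le.
have oN : #|N| = 3 := extremal_complement_card pP iP' sylP nsNG oddN ntN.
have nNP : P \subset 'N(N)%g := subset_trans sPG (normal_norm nsNG).
have [odd_n _] := extremal_odd_orbit pP iP' oddN nNP ntN; rewrite card_ord in odd_n.
(* [n] is odd; [n = 1] leaves no room for a subgroup of order 3, and [n = 3] is excluded by
   hypothesis. *)
have half_n : 1 < n./2.
  have: 3 <= n`! by rewrite -oN -card_Sn max_card.
  by move: n_neq3 odd_n; case: (n) => [|[|[|[|[|m']]]]].
apply: Rle_trans (sum_cubic_le half_n m_gt3) _; apply: sum_Rle => j _.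
rewrite -span_prob_nu; exact: probgen_complement3 nsNG oN sylP defG eK iK tiPK iP.
Qed.
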